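(* Let $\mathfrak A$ and $\mathcal A$ be Banach algebras with $\mathcal A$ a Banach $\mathfrak A$-bimodule with compatible actions, and let $\mathcal B=\mathcal A\oplus\mathfrak A^\#$ as below. The following are equivalent: (i) $\mathcal B$ is $\mathfrak A^\#$-module approximately contractible; (ii) $\mathcal B$ is $\mathfrak A^\#$-module approximately amenable; (iii) $\mathcal B$ is $\mathfrak A^\#$-module $w^*$-approximately amenable.
   Context: Compatible actions: $\alpha\cdot(ab)=(\alpha\cdot a)b$, $(ab)\cdot\alpha=a(b\cdot\alpha)$. $\mathfrak A^\#=\mathfrak A\oplus\mathbb C$ is the unitization, acting on $\mathcal A$ by $(\alpha,\lambda)\cdot a=\alpha\cdot a+\lambda a$, $a\cdot(\alpha,\lambda)=a\cdot\alpha+\lambda a$. $\mathcal B=\mathcal A\oplus\mathfrak A^\#$ with product $(a,u)\bullet(b,v)=(ab+a\cdot v+u\cdot b,uv)$ and $\mathfrak A^\#$-actions $u\cdot(a,v)=(u\cdot a,uv)$, $(a,v)\cdot u=(a\cdot u,vu)$. Module notions: for a Banach algebra $\mathcal C$ that is a $\mathfrak C$-bimodule with compatible actions, a Banach $\mathcal C$-$\mathfrak C$-module is a Banach space $X$ which is a $\mathcal C$-bimodule and $\mathfrak C$-bimodule with $\alpha\cdot(c\cdot x)=(\alpha\cdot c)\cdot x$, $c\cdot(\alpha\cdot x)=(c\cdot\alpha)\cdot x$, $c\cdot(x\cdot\alpha)=(c\cdot x)\cdot\alpha$ and analogous right identities; commutative if $\alpha\cdot x=x\cdot\alpha$; $X^*$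 has the dual actions. A module derivation $D:\mathcal C\to Y$ is additive, bounded ($\|D(c)\|\le M\|c\|$), with $D(cd)=D(c)\cdot d+c\cdot D(d)$, $D(\alpha\cdot c)=\alpha\cdot D(c)$, $D(c\cdot\alpha)=D(c)\cdot\alpha$. $\mathcal C$ is $\mathfrak C$-module approximately contractible if for every commutative Banach $\mathcal C$-$\mathfrak C$-module $X$ every module derivation $D:\mathcal C\to X$ satisfies $D(c)=\lim_i(c\cdot x_i-x_i\cdot c)$ in norm for some net in $X$; approximately amenable (resp. $w^*$-approximately amenable) if every module derivation $D:\mathcal C\to X^*$ satisfies $c\cdot f_i-f_i\cdot c\to D(c)$ in norm (resp. weak$^*$) for some net $(f_i)\subseteq X^*$. *)

(* Defs.v *)
From HB Require Import structures.
From mathcomp Require Import all_boot all_order all_algebra.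
From mathcomp Require Import complex.
From mathcomp Require Import all_classical all_reals all_analysis.
Set Implicit Arguments. Unset Strict Implicit. Unset Printing Implicit Defensive.
Import Order.TTheory GRing.Theory Num.Theory.
Import numFieldNormedType.Exports.
Local Open Scope ring_scope.

Section Defs.
Variable R : realType.
Local Notation K := (R[i]).

Definition bilinear_op {A B X : normedModType K} (op : A -> B -> X) : Prop :=
  (forall a a' b, op (a + a') b = op a b + op a' b) /\
  (forall a b b', op a (b + b') = op a b + op a b') /\
  (forall (k : K) a b, op (k *: a) b = k *: op a b) /\
  (forall (k : K) a b, op a (k *: b) = k *: op a b).

(* a Banach algebra (not necessarily unital): associative bilinear
   product with submultiplicative norm; completeness is carried by the type *)
Definition banach_algebra {A : normedModType K} (mul : A -> A -> A) : Prop :=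
  bilinear_op mul /\
  (forall a b c, mul (mul a b) c = mul a (mul b c)) /\
  (forall a b, `|mul a b| <= `|a| * `|b|).

Definition banach_bimodule_compat {U A : normedModType K}
  (mulU : U -> U -> U) (mulA : A -> A -> A)
  (l : U -> A -> A) (r : A -> U -> A) : Prop :=
  bilinear_op l /\ bilinear_op r /\
  (forall u a, `|l u a| <= `|u| * `|a|) /\
  (forall a u, `|r a u| <= `|a| * `|u|) /\
  (forall u v a, l (mulU u v) a = l u (l v a)) /\
  (forall a u v, r a (mulU u v) = r (r a u) v) /\
  (forall u a v, l u (r a v) = r (l u a) v) /\
  (forall u a b, l u (mulA a b) = mulA (l u a) b) /\
  (forall a b u, r (mulA a b) u = mulA a (r b u)).

Definition banach_module {C Cm : normedModType K} (mulC : C -> C -> C)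
  (mulCm : Cm -> Cm -> Cm) (lC : Cm -> C -> C) (rC : C -> Cm -> C)
  {X : normedModType K} (lX : C -> X -> X) (rX : X -> C -> X)
  (laX : Cm -> X -> X) (raX : X -> Cm -> X) : Prop :=
  bilinear_op lX /\ bilinear_op rX /\
  (exists M : K, forall c x, `|lX c x| <= M * `|c| * `|x|) /\
  (exists M : K, forall x c, `|rX x c| <= M * `|x| * `|c|) /\
  (forall c d x, lX (mulC c d) x = lX c (lX d x)) /\
  (forall x c d, rX x (mulC c d) = rX (rX x c) d) /\
  (forall c x d, lX c (rX x d) = rX (lX c x) d) /\
  bilinear_op laX /\ bilinear_op raX /\
  (exists M : K, forall a x, `|laX a x| <= M * `|a| * `|x|) /\
  (exists M : K, forall x a, `|raX x a| <= M * `|x| * `|a|) /\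
  (forall a b x, laX (mulCm a b) x = laX a (laX b x)) /\
  (forall x a b, raX x (mulCm a b) = raX (raX x a) b) /\
  (forall a x b, laX a (raX x b) = raX (laX a x) b) /\
  (forall a c x, laX a (lX c x) = lX (lC a c) x) /\
  (forall c a x, lX c (laX a x) = lX (rC c a) x) /\
  (forall c x a, lX c (raX x a) = raX (lX c x) a) /\
  (forall x c a, raX (rX x c) a = rX x (rC c a)) /\
  (forall x a c, rX (raX x a) c = rX x (lC a c)) /\
  (forall a x c, laX a (rX x c) = rX (laX a x) c).

Definition commutative_module {Cm X : normedModType K}
  (laX : Cm -> X -> X) (raX : X -> Cm -> X) : Prop :=
  forall a x, laX a x = raX x a.

Definition directed {I : Type} (le : I -> I -> Prop) : Prop :=
  (exists i : I, True) /\ (forall i, le i i) /\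
  (forall i j k, le i j -> le j k -> le i k) /\
  (forall i j, exists k, le i k /\ le j k).

Definition net_cvg {I : Type} (le : I -> I -> Prop) {X : normedModType K}
  (u : I -> X) (L : X) : Prop :=
  forall eps : K, 0 < eps -> exists i0, forall i, le i0 i -> `|u i - L| < eps.

Definition in_dual {X : normedModType K} (f : X -> K) : Prop :=
  (forall x y, f (x + y) = f x + f y) /\
  (forall (k : K) x, f (k *: x) = k * f x) /\
  (exists M : K, forall x, `|f x| <= M * `|x|).

Definition dual_norm_cvg {I : Type} (le : I -> I -> Prop) {X : normedModType K}
  (g : I -> X -> K) (L : X -> K) : Prop :=
  forall eps : K, 0 < eps -> exists i0, forall i, le i0 i ->
    forall x, `|g i x - L x| <= eps * `|x|.

Definition dual_wstar_cvg {I : Type} (le : I -> I -> Prop) {X : normedModType K}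
  (g : I -> X -> K) (L : X -> K) : Prop :=
  forall x, forall eps : K, 0 < eps -> exists i0, forall i, le i0 i ->
    `|g i x - L x| < eps.

Definition module_derivation {C Cm : normedModType K}
  (mulC : C -> C -> C) (lC : Cm -> C -> C) (rC : C -> Cm -> C)
  {X : normedModType K} (lX : C -> X -> X) (rX : X -> C -> X)
  (laX : Cm -> X -> X) (raX : X -> Cm -> X) (D : C -> X) : Prop :=
  (forall c d, D (c + d) = D c + D d) /\
  (exists M : K, forall c, `|D c| <= M * `|c|) /\
  (forall c d, D (mulC c d) = rX (D c) d + lX c (D d)) /\
  (forall a c, D (lC a c) = laX a (D c)) /\
  (forall c a, D (rC c a) = raX (D c) a).

(* module derivation into the dual X^*, with the dual actions
   (c.f)(x) = f(x.c), (f.c)(x) = f(c.x), and likewise for Cm *)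
Definition dual_module_derivation {C Cm : normedModType K}
  (mulC : C -> C -> C) (lC : Cm -> C -> C) (rC : C -> Cm -> C)
  {X : normedModType K} (lX : C -> X -> X) (rX : X -> C -> X)
  (laX : Cm -> X -> X) (raX : X -> Cm -> X) (D : C -> X -> K) : Prop :=
  (forall c, in_dual (D c)) /\
  (forall c d x, D (c + d) x = D c x + D d x) /\
  (exists M : K, forall c x, `|D c x| <= M * `|c| * `|x|) /\
  (* D(cd) = D(c).d + c.D(d) *)
  (forall c d x, D (mulC c d) x = D c (lX d x) + D d (rX x c)) /\
  (* D(a.c) = a.D(c) *)
  (forall a c x, D (lC a c) x = D c (raX x a)) /\
  (* D(c.a) = D(c).a *)
  (forall c a x, D (rC c a) x = D c (laX a x)).

Definition module_approx_contractible {C Cm : normedModType K}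
  (mulC : C -> C -> C) (mulCm : Cm -> Cm -> Cm)
  (lC : Cm -> C -> C) (rC : C -> Cm -> C) : Prop :=
  forall (X : completeNormedModType K) (lX : C -> X -> X) (rX : X -> C -> X)
         (laX : Cm -> X -> X) (raX : X -> Cm -> X) (D : C -> X),
    banach_module mulC mulCm lC rC lX rX laX raX ->
    commutative_module laX raX ->
    module_derivation mulC lC rC lX rX laX raX D ->
    exists (I : Type) (le : I -> I -> Prop) (x : I -> X),
      directed le /\
      forall c, net_cvg le (fun i => lX c (x i) - rX (x i) c) (D c).

Definition module_approx_amenable {C Cm : normedModType K}
  (mulC : C -> C -> C) (mulCm : Cm -> Cm -> Cm)
  (lC : Cm -> C -> C) (rC : C -> Cm -> C) : Prop :=
  forall (X : completeNormedModType K) (lX : C -> X -> X) (rX : X -> C -> X)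
         (laX : Cm -> X -> X) (raX : X -> Cm -> X) (D : C -> X -> K),
    banach_module mulC mulCm lC rC lX rX laX raX ->
    commutative_module laX raX ->
    dual_module_derivation mulC lC rC lX rX laX raX D ->
    exists (I : Type) (le : I -> I -> Prop) (f : I -> X -> K),
      directed le /\ (forall i, in_dual (f i)) /\
      (* c.f_i - f_i.c -> D(c) in norm;  (c.f - f.c)(x) = f(x.c) - f(c.x) *)
      forall c, dual_norm_cvg le (fun i x => f i (rX x c) - f i (lX c x)) (D c).

Definition module_wstar_approx_amenable {C Cm : normedModType K}
  (mulC : C -> C -> C) (mulCm : Cm -> Cm -> Cm)
  (lC : Cm -> C -> C) (rC : C -> Cm -> C) : Prop :=
  forall (X : completeNormedModType K) (lX : C -> X -> X) (rX : X -> C -> X)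
         (laX : Cm -> X -> X) (raX : X -> Cm -> X) (D : C -> X -> K),
    banach_module mulC mulCm lC rC lX rX laX raX ->
    commutative_module laX raX ->
    dual_module_derivation mulC lC rC lX rX laX raX D ->
    exists (I : Type) (le : I -> I -> Prop) (f : I -> X -> K),
      directed le /\ (forall i, in_dual (f i)) /\
      forall c, dual_wstar_cvg le (fun i x => f i (rX x c) - f i (lX c x)) (D c).

Section Construction.
Variables (U A : normedModType K).
Variables (mulU : U -> U -> U) (mulA : A -> A -> A)
          (l : U -> A -> A) (r : A -> U -> A).

Definition unitz := (U * K^o)%type.
Definition unitz_mul (u v : unitz) : unitz :=
  (mulU u.1 v.1 + u.2 *: v.1 + v.2 *: u.1, u.2 * v.2).
Definition unitz_lact (u : unitz) (a : A) : A := l u.1 a + u.2 *: a.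
Definition unitz_ract (a : A) (u : unitz) : A := r a u.1 + u.2 *: a.

Definition Balg := (A * unitz)%type.
Definition B_mul (x y : Balg) : Balg :=
  (mulA x.1 y.1 + unitz_ract x.1 y.2 + unitz_lact x.2 y.1,
   unitz_mul x.2 y.2).
Definition B_lact (u : unitz) (x : Balg) : Balg :=
  (unitz_lact u x.1, unitz_mul u x.2).
Definition B_ract (x : Balg) (u : unitz) : Balg :=
  (unitz_ract x.1 u, unitz_mul x.2 u).
End Construction.
End Defs.

(* Main.v *)
(* The dual of a commutative Banach module is a commutative Banach module, so
   approximate contractibility gives approximate amenability, and norm convergence
   gives weak* convergence.  Conversely, a derivation D : B -> X composed with
   X -> X** is weak*-approximately inner.  For finitely many c in B the tuples
   (c x - x c)_c form a subspace of X^n; if (D c)_c were not in its closure,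
   Hahn-Banach would give functionals phi_c with sum (phi_c . c - c . phi_c) = 0
   and sum phi_c (D c) <> 0, and evaluating the weak* net of X** on the phi_c is a
   contradiction.  So D is a norm limit of inner derivations along the net indexed
   by finite subsets of B and tolerances. *)
Require Import Defs.
From HB Require Import structures.
From mathcomp Require Import all_boot all_order all_algebra.
From mathcomp Require Import complex.
From mathcomp Require Import all_classical all_reals all_analysis.
From mathcomp Require Import ring lra.
Set Implicit Arguments. Unset Strict Implicit. Unset Printing Implicit Defensive.
Import Order.TTheory GRing.Theory Num.Theory.
Import numFieldNormedType.Exports.
Local Open Scope classical_set_scope.
Local Open Scope ring_scope.

(** * Hahn-Banach theorem *)

Definition sublinear (R : realType) (V : lmodType R) (p : V -> R) : Prop :=
  (forall x y, p (x + y) <= p x + p y) /\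
  (forall (a : R) x, 0 <= a -> p (a *: x) = a * p x).

Section SublinearFunctionals.
Variables (R : realType) (V : lmodType R).
Implicit Types (p q : V -> R) (x y : V).

Lemma sublinear0 p : sublinear p -> p 0 = 0.
Proof. by case=> _ pZ; rewrite -(scale0r 0) pZ// mul0r. Qed.

Lemma sublinear_geN p x : sublinear p -> - p (- x) <= p x.
Proof.
move=> sp; have := sp.1 x (- x); rewrite subrr (sublinear0 sp); lra.
Qed.

(** The auxiliary functional of the minimality argument: it lies below [p], and the choice [t = 1]
    gives the value at [- x] at most [- p x]. The infimum is finite because [- p (- y)] is a lower
    bound. *)
Definition tilt p x y : R := inf [set p (y + t *: x) - t * p x | t in [set t | 0 <= t]].

Lemma tilt_lb p x y (t : R) : sublinear p -> 0 <= t -> - p (- y) <= p (y + t *: x) - t * p x.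
Proof.
move=> sp t0; rewrite -(sp.2 _ _ t0).
have := sp.1 (y + t *: x) (- y); rewrite addrAC subrr add0r; lra.
Qed.

Lemma tilt_le p x y (t : R) : sublinear p -> 0 <= t ->
  tilt p x y <= p (y + t *: x) - t * p x.
Proof.
move=> sp t0; apply: ge_inf; last by exists t.
by exists (- p (- y)) => _ [s /= s0 <-]; exact: tilt_lb.
Qed.

Lemma le_tilt p x y (m : R) :
  (forall t : R, 0 <= t -> m <= p (y + t *: x) - t * p x) -> m <= tilt p x y.
Proof.
move=> H; apply: lb_le_inf; first by exists (p (y + 0 *: x) - 0 * p x); exists 0 => /=.
by move=> _ [t /= t0 <-]; exact: H.
Qed.

Lemma tilt_le_id p x y : sublinear p -> tilt p x y <= p y.
Proof.
by move=> sp; have := tilt_le x y sp (lexx 0); rewrite scale0r addr0 mul0r subr0.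
Qed.

(** Parameters [s] for [y] and [t] for [z] combine to [s + t] for [y + z], and scaling by [a > 0]
    rescales the parameter by [a]. *)
Lemma sublinear_tilt p x : sublinear p -> sublinear (tilt p x).
Proof.
move=> sp; split=> [y z|a y].
  rewrite -lerBlDr; apply: le_tilt => s s0; rewrite lerBlDr -lerBlDl.
  apply: le_tilt => t t0; rewrite lerBlDl.
  apply: le_trans (tilt_le _ _ sp (addr_ge0 s0 t0)) _.
  have := sp.1 (y + s *: x) (z + t *: x).
  rewrite addrACA -scalerDl; lra.
rewrite le_eqVlt => /predU1P[<-|a0].
  rewrite scale0r mul0r; apply/eqP; rewrite eq_le; apply/andP; split.
    by rewrite -(sublinear0 sp) tilt_le_id.
  by apply: le_tilt => t t0; rewrite add0r sp.2// subrr.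
apply/eqP; rewrite eq_le; apply/andP; split.
  rewrite mulrC -ler_pdivrMr//; apply: le_tilt => t t0.
  rewrite ler_pdivrMr//.
  apply: le_trans (tilt_le _ _ sp (mulr_ge0 (ltW a0) t0)) _.
  rewrite -scalerA -scalerDr (sp.2 _ _ (ltW a0)); lra.
apply: le_tilt => t t0; rewrite mulrC -ler_pdivlMr//.
apply: le_trans (tilt_le _ _ sp (divr_ge0 t0 (ltW a0))) _.
rewrite ler_pdivlMr// mulrC mulrBr -(sp.2 _ _ (ltW a0)) scalerDr scalerA.
by rewrite !mulrA mulrAC divff ?gt_eqF// mul1r.
Qed.

(** Zorn's lemma for the reversed pointwise order. A nonempty chain is bounded by its pointwise
    infimum, which is finite because every member is at least [- p (- x)] at [x]. *)
Lemma exists_minimal_sublinear p : sublinear p ->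
  exists q, [/\ sublinear q, (forall x, q x <= p x) &
    forall q', sublinear q' -> (forall x, q' x <= q x) -> q' = q].
Proof.
move=> sp.
pose T := {q | sublinear q /\ forall x, q x <= p x}.
pose le (s t : T) := `[< forall x, sval t x <= sval s x >].
have lb (s : T) x : - p (- x) <= sval s x.
  case: s => q [sq qp] /=; apply: le_trans (sublinear_geN x sq).
  by rewrite lerN2 qp.
have [] := @Zorn T le.
- by move=> s; apply/asboolP.
- move=> r s t /asboolP rs /asboolP st; apply/asboolP => x.
  exact: le_trans (st x) (rs x).
- move=> [s sP] [t tP] /asboolP/= st /asboolP/= ts; apply: eq_exist.
  by apply/funext => x; apply/eqP; rewrite eq_le st ts.
- move=> A Atot; have [->|/set0P[s0 As0]] := eqVneq A set0.
    by exists (exist _ p (conj sp (fun x => lexx _))).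
  pose q x := inf [set sval s x | s in A].
  have qle s x : A s -> q x <= sval s x.
    move=> As; apply: ge_inf; last by exists s.
    by exists (- p (- x)) => _ [t _ <-]; exact: lb.
  have q_glb x m : (forall s, A s -> m <= sval s x) -> m <= q x.
    move=> H; apply: lb_le_inf; first by exists (sval s0 x); exists s0.
    by move=> _ [t At <-]; exact: H.
  have sq : sublinear q.
    split=> [x y|a x a0].
      rewrite -lerBlDr; apply: (q_glb _ _) => s As; rewrite lerBlDr -lerBlDl.
      apply: (q_glb _ _) => t At; rewrite lerBlDl.
      (* The infima at [x] and [y] are approached by different members [s] and [t]; the smaller of
         the two in the chain serves at both points. *)
      have [/asboolP ts|/asboolP st] := Atot _ _ As At.
        apply: le_trans (qle t _ At) _.
        apply: le_trans ((svalP t).1.1 _ _) _; apply: lerD => //.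
      apply: le_trans (qle s _ As) _.
      apply: le_trans ((svalP s).1.1 _ _) _; apply: lerD => //.
    apply/eqP; rewrite eq_le; apply/andP; split.
      move: a0; rewrite [0 <= a]le_eqVlt => /predU1P[<-|a0].
        rewrite scale0r mul0r.
        by apply: le_trans (qle s0 _ As0) _; rewrite (sublinear0 (svalP s0).1).
      rewrite mulrC -ler_pdivrMr//; apply: (q_glb _ _) => s As; rewrite ler_pdivrMr//.
      apply: le_trans (qle s _ As) _.
      by rewrite ((svalP s).1.2 _ _ (ltW a0)) mulrC.
    by apply: (q_glb _ _) => s As; rewrite (svalP s).1.2// ler_wpM2l// qle.
  have qp x : q x <= p x by apply: le_trans (qle s0 _ As0) ((svalP s0).2 x).
  exists (exist _ q (conj sq qp)) => s As; apply/asboolP => x; exact: qle.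
move=> [q [sq qp]] qmin; exists q; split=> // q' sq' q'q.
have q'p x : q' x <= p x := le_trans (q'q x) (qp x).
by have /(congr1 sval) := qmin (exist _ q' (conj sq' q'p)) (introT (asboolP _) q'q).
Qed.

(* A minimal sublinear functional equals all its tilts, which forces
   additivity; tilting at [x0] first makes the minimum tight there. *)
Lemma hahn_banach_real p (x0 : V) : sublinear p ->
  exists f : V -> R, [/\ forall x y, f (x + y) = f x + f y,
    forall (a : R) x, f (a *: x) = a * f x, forall x, f x <= p x & f x0 = p x0].
Proof.
move=> sp; have st := sublinear_tilt x0 sp.
have [f [sf fp fmin]] := exists_minimal_sublinear st.
have fD x y : f (x + y) = f x + f y.
  apply/eqP; rewrite eq_le sf.1/=.
  have := tilt_le y x sf ler01; rewrite scale1r mul1r.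
  have -> := fmin _ (sublinear_tilt y sf) (fun z => tilt_le_id y z sf).
  lra.
have fN x : f (- x) = - f x.
  by apply/eqP; rewrite -subr_eq0 opprK addrC -fD subrr (sublinear0 sf).
have fle x : f x <= p x := le_trans (fp x) (tilt_le_id x0 x sp).
exists f; split=> //.
  move=> a x; have [a0|/ltW a0] := leP 0 a; first exact: sf.2.
  by apply: oppr_inj; rewrite -fN -scaleNr sf.2 ?oppr_ge0// mulNr.
apply/eqP; rewrite eq_le fle/= -lerN2 -fN; apply: le_trans (fp _) _.
have := tilt_le x0 (- x0) sp ler01.
by rewrite scale1r addNr (sublinear0 sp) sub0r mul1r.
Qed.

End SublinearFunctionals.

(** * Complex Hahn-Banach theorem and separation from a subspace *)

Section ComplexHahnBanach.
Variable R : realType.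
Local Notation K := (R[i]).
Local Open Scope complex_scope.

(** An alias for [V], so that the real scaling does not clash with the complex one on the same
    type. *)
Definition realification (V : lmodType K) : Type := V.

Section Realification.
Variable V : lmodType K.

HB.instance Definition _ := GRing.Zmodule.copy (realification V) V.

Definition real_scale (a : R) (x : realification V) : realification V :=
  a%:C *: (x : V).

Lemma real_scaleA a b x : real_scale a (real_scale b x) = real_scale (a * b) x.
Proof. by rewrite /real_scale scalerA rmorphM. Qed.

Lemma real_scale1 : left_id 1 real_scale.
Proof. by move=> x; rewrite /real_scale rmorph1 scale1r. Qed.

Lemma real_scaleDr : right_distributive real_scale +%R.
Proof. by move=> a x y; rewrite /real_scale scalerDr. Qed.

Lemma real_scaleDl x : {morph real_scale^~ x : a b / a + b}.
Proof. by move=> a b; rewrite /real_scale rmorphD scalerDl. Qed.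

HB.instance Definition _ := GRing.Zmodule_isLmodule.Build R (realification V)
  real_scaleA real_scale1 real_scaleDr real_scaleDl.

End Realification.

Definition seminorm (V : lmodType K) (p : V -> R) : Prop :=
  (forall x y, p (x + y) <= p x + p y) /\
  (forall (k : K) x, p (k *: x) = complex.Re `|k| * p x).

Lemma seminorm_ge0 (V : lmodType K) (p : V -> R) x : seminorm p -> 0 <= p x.
Proof.
move=> [pD pZ]; have := pD x (- x); rewrite subrr.
rewrite -{1}(scale0r 0) pZ normr0 mul0r -scaleN1r pZ normrN1 mul1r; lra.
Qed.

Lemma norm_Re (X : normedModType K) (x : X) : (complex.Re `|x|)%:C = `|x|.
Proof. by rewrite RRe_real// normr_real. Qed.

(** A complex functional is determined by its real part [g] through [f x = g x - i g (i x)], so the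
    real theorem supplies [g]. *)
Lemma hahn_banach_complex (V : lmodType K) (p : V -> R) (x0 : V) : seminorm p ->
  exists f : V -> K, [/\ forall x y, f (x + y) = f x + f y,
    forall (k : K) x, f (k *: x) = k * f x,
    forall x, `|f x| <= (p x)%:C & complex.Re (f x0) = p x0].
Proof.
move=> [pD pZ].
have [|g [gD gZ gp gx0]] := @hahn_banach_real R (realification V) p x0.
  split=> // a x a0; rewrite [LHS](pZ a%:C x) ger0_norm ?ler0c//.
pose f (x : V) : K := g x +i* - g ('i *: x).
have fD x y : f (x + y) = f x + f y.
  by rewrite /f; simpc; rewrite scalerDr !gD opprD.
have fi x : f ('i *: x) = 'i * f x.
  rewrite /f; simpc; rewrite scalerA -expr2 sqr_i scaleN1r.
  have -> : g (- x) = - g x.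
    by have := gZ (-1) x; rewrite mulN1r => <-; rewrite scaleN1r.
  by rewrite !opprK.
have fR (a : R) x : f (a%:C *: x) = a%:C * f x.
  rewrite /f; simpc; rewrite scalerA mulrC -scalerA.
  by rewrite [g (_ *: x)](gZ a x) [g (_ *: (_ *: x))](gZ a ('i *: x)).
have fZ (k : K) x : f (k *: x) = k * f x.
  by rewrite [k]complexE scalerDl fD -scalerA fi !fR mulrDl mulrA.
exists f; split=> // x.
have [->|fx0] := eqVneq (f x) 0.
  by rewrite normr0 ler0c seminorm_ge0.
have nx0 : `|f x| != 0 by rewrite normr_eq0.
(* The unimodular [k] rotates [f x] onto the positive reals, so [f (k *: x)] equals its real part
   [g (k *: x)], which is at most [p (k *: x) = p x]. *)
pose k : K := `|f x| / f x.
have nk : `|k| = 1 by rewrite normf_div normr_id divff.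
have fk : f (k *: x) = `|f x| by rewrite fZ divfK.
rewrite -(RRe_real (normr_real (f x))) lecR -fk.
apply: le_trans (gp _) _.
by rewrite [leLHS]pZ nk mul1r.
Qed.

(** The [N]-distance [p] to [W] is a seminorm below [N] that vanishes on [W]. If [p d = 0] then [d]
    is approximated by [W]; otherwise a functional dominated by [p] and tight at [d] separates. *)
Lemma subspace_separation (V : lmodType K) (N : V -> R) (W : set V) (d : V) :
  seminorm N -> W 0 -> (forall x y, W x -> W y -> W (x + y)) ->
  (forall (k : K) x, W x -> W (k *: x)) ->
  (forall e, 0 < e -> exists2 w, W w & N (d - w) < e) \/
  (exists f : V -> K, [/\ forall x y, f (x + y) = f x + f y,
    forall (k : K) x, f (k *: x) = k * f x,
    forall x, `|f x| <= (N x)%:C, forall w, W w -> f w = 0 & f d != 0]).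
Proof.
move=> sN W0 WD WZ.
pose p x := inf [set N (x - w) | w in W].
have p_le x w : W w -> p x <= N (x - w).
  move=> Ww; apply: ge_inf; last by exists w.
  by exists 0 => _ [v _ <-]; exact: seminorm_ge0.
have p_glb x m : (forall w, W w -> m <= N (x - w)) -> m <= p x.
  move=> H; apply: lb_le_inf; first by exists (N (x - 0)); exists 0.
  by move=> _ [w Ww <-]; exact: H.
have p0 x : 0 <= p x by apply: (p_glb _ _) => w _; exact: seminorm_ge0.
have pZle (k : K) x : p (k *: x) <= complex.Re `|k| * p x.
  have [->|k0] := eqVneq k 0.
    rewrite scale0r normr0 mul0r; apply: le_trans (p_le _ _ W0) _.
    by rewrite subrr -(scale0r 0) sN.2 normr0 mul0r.
  have nk : 0 < complex.Re `|k| by rewrite -ltcR RRe_real ?normr_real// normr_gt0.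
  rewrite mulrC -ler_pdivrMr//; apply: (p_glb _ _) => w Ww.
  rewrite ler_pdivrMr//; apply: le_trans (p_le _ _ (WZ k _ Ww)) _.
  by rewrite -scalerBr sN.2 mulrC.
have sp : seminorm p.
  split=> [x y|k x].
    rewrite -lerBlDr; apply: (p_glb _ _) => w Ww; rewrite lerBlDr -lerBlDl.
    apply: (p_glb _ _) => v Wv; rewrite lerBlDl.
    apply: le_trans (p_le _ _ (WD _ _ Ww Wv)) _.
    by rewrite opprD addrACA sN.1.
  apply/eqP; rewrite eq_le pZle andTb.
  have [->|k0] := eqVneq k 0; first by rewrite normr0 mul0r.
  have nk : 0 < complex.Re `|k| by rewrite -ltcR RRe_real ?normr_real// normr_gt0.
  (* The reverse inequality is the one already proved, applied to [k^-1] and [k *: x]. *)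
  have := pZle k^-1 (k *: x); rewrite scalerA mulVf// scale1r => H.
  rewrite mulrC -ler_pdivlMr// mulrC; apply: le_trans H _.
  rewrite ler_wpM2r// -lecR fmorphV !RRe_real ?normr_real//.
  by rewrite normfV.
have [pd0|pd0] := eqVneq (p d) 0; [left => e e0|right].
  have : has_inf [set N (d - w) | w in W].
    split; first by exists (N (d - 0)); exists 0.
    by exists 0 => _ [v _ <-]; exact: seminorm_ge0.
  move=> /(inf_adherent e0)[_ [w Ww <-]].
  by rewrite -[inf _]/(p d) pd0 add0r; exists w.
have [f [fD fZ fp fd]] := hahn_banach_complex d sp.
exists f; split=> //.
- move=> x; apply: le_trans (fp x) _; rewrite lecR.
  by apply: le_trans (p_le _ _ W0) _; rewrite subr0.
- move=> w Ww; apply/eqP; rewrite -normr_le0; apply: le_trans (fp w) _.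
  rewrite lecR; apply: le_trans (p_le _ _ Ww) _.
  by rewrite subrr -(scale0r 0) sN.2 normr0 mul0r.
- by apply: contra_neq pd0 => fd0; rewrite -fd fd0.
Qed.

End ComplexHahnBanach.

(** * Dual space *)

(** Boundedness is stated with an arbitrary complex constant [M]. Since [M * z] dominates [y >= 0],
    it equals its own modulus, so [M] may be replaced by the nonnegative [|M|]. *)
Lemma ler_normM (F : numDomainType) (M y z : F) : 0 <= y -> 0 <= z ->
  y <= M * z -> y <= `|M| * z.
Proof.
move=> y0 z0 yM; rewrite -[z in leRHS]ger0_norm// -normrM ger0_norm//.
exact: le_trans yM.
Qed.

Lemma real_complexD (R : realType) (a b : R) : (a + b)%:C%C = a%:C%C + b%:C%C.
Proof. exact: rmorphD. Qed.

Lemma real_complexM (R : realType) (a b : R) : (a * b)%:C%C = a%:C%C * b%:C%C.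
Proof. exact: rmorphM. Qed.

Section DualSpace.
Variable R : realType.
Local Notation K := (R[i]).
Local Open Scope complex_scope.
Variable X : normedModType K.

Definition dual_pred : {pred X -> K^o} := fun f => `[< in_dual f >].

Lemma dual_predP f : reflect (in_dual f) (f \in dual_pred).
Proof. exact: asboolP. Qed.

Lemma in_dual_bound (f : X -> K) : in_dual f ->
  exists2 M : R, 0 <= M & forall x, `|f x| <= M%:C * `|x|.
Proof.
move=> [_ [_ [M fM]]]; exists (complex.Re `|M|) => [|x].
  by rewrite -ler0c RRe_real ?normr_real.
by rewrite RRe_real ?normr_real// ler_normM.
Qed.

Lemma in_dualB (f : X -> K) x y : in_dual f -> f (x - y) = f x - f y.
Proof. by move=> [fD [fZ _]]; rewrite fD -scaleN1r fZ mulN1r. Qed.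

Lemma dual_pred_submod_closed : submod_closed dual_pred.
Proof.
split.
  apply/dual_predP; split; first by move=> x y; rewrite addr0.
  split; first by move=> k x; rewrite mulr0.
  by exists 0 => x; rewrite normr0 mul0r.
move=> k f g /dual_predP df /dual_predP dg; apply/dual_predP.
have [M M0 fM] := in_dual_bound df; have [N N0 gN] := in_dual_bound dg.
case: df dg => fD [fZ _] [gD [gZ _]].
have E z : (k *: f + g) z = k * f z + g z by [].
split; first by move=> x y; rewrite !E fD gD mulrDr addrACA.
split; first by move=> a x; rewrite !E fZ gZ mulrDr mulrCA.
exists (`|k| * M%:C + N%:C) => x.
apply: le_trans (ler_normD _ _) _; rewrite mulrDl lerD// -mulrA normrM.
by rewrite ler_wpM2l.
Qed.

HB.instance Definition _ :=
  GRing.isSubmodClosed.Build K (X -> K^o) dual_pred dual_pred_submod_closed.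

Record dual : Type := Dual { dual_fun :> X -> K^o; _ : dual_fun \in dual_pred }.

HB.instance Definition _ := [isSub for dual_fun].
HB.instance Definition _ := [Choice of dual by <:].
HB.instance Definition _ := [SubChoice_isSubLmodule of dual by <:].

Lemma dualP (f : dual) : in_dual f.
Proof. by apply/dual_predP; exact: valP. Qed.

Lemma dual_ext (f g : dual) : (forall x, f x = g x) -> f = g.
Proof. by move=> fg; apply: val_inj; apply/funext. Qed.

Lemma dualDE (f g : dual) x : (f + g) x = f x + g x. Proof. by []. Qed.
Lemma dualZE (k : K) (f : dual) x : (k *: f) x = k * f x. Proof. by []. Qed.
Lemma dualBE (f g : dual) x : (f - g) x = f x - g x. Proof. by []. Qed.

(** The operator norm as the least admissible bound; being real-valued, it can be taken as an
    infimum in [R]. *)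
Definition opnorm (f : X -> K) : R :=
  inf [set M : R | 0 <= M /\ forall x, `|f x| <= M%:C * `|x|].

Lemma opnorm_ge0 f : in_dual f -> 0 <= opnorm f.
Proof.
by move=> /in_dual_bound[M M0 fM]; apply: lb_le_inf; [exists M|move=> N []].
Qed.

Lemma opnorm_le f (M : R) : 0 <= M -> (forall x, `|f x| <= M%:C * `|x|) ->
  opnorm f <= M.
Proof. by move=> M0 fM; apply: ge_inf => //; exists 0 => N []. Qed.

(** For [x] of nonzero norm, each admissible bound is at least [|f x| / |x|], hence so is their
    infimum: the infimum is itself admissible. *)
Lemma le_opnorm f x : in_dual f -> `|f x| <= (opnorm f)%:C * `|x|.
Proof.
move=> df; have [M M0 fM] := in_dual_bound df.
have [x0|x0] := eqVneq `|x| 0.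
  by have := fM x; rewrite x0 !mulr0.
have nx : 0 < complex.Re `|x|.
  by rewrite -ltcR norm_Re lt_def x0 normr_ge0.
rewrite -[`|f x|]RRe_real ?normr_real// -[`|x|]norm_Re -real_complexM lecR.
rewrite -ler_pdivrMr//; apply: lb_le_inf; first by exists M.
move=> N [N0 fN]; rewrite ler_pdivrMr// -lecR real_complexM !RRe_real ?normr_real//.
Qed.

Definition dual_norm (f : dual) : K := (opnorm f)%:C.

Lemma dual_normD f g : dual_norm (f + g) <= dual_norm f + dual_norm g.
Proof.
rewrite -real_complexD lecR; apply: opnorm_le.
  by rewrite addr_ge0// opnorm_ge0//; exact: dualP.
move=> x; rewrite dualDE; apply: le_trans (ler_normD _ _) _.
by rewrite real_complexD mulrDl lerD// le_opnorm//; exact: dualP.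
Qed.

Lemma dual_normZ_le (k : K) f : dual_norm (k *: f) <= `|k| * dual_norm f.
Proof.
rewrite -(RRe_real (normr_real k)) -real_complexM lecR; apply: opnorm_le.
  rewrite mulr_ge0 ?opnorm_ge0//; last exact: dualP.
  by rewrite -ler0c RRe_real ?normr_real.
move=> x; rewrite dualZE normrM real_complexM RRe_real ?normr_real// -mulrA.
by rewrite ler_wpM2l// le_opnorm//; exact: dualP.
Qed.

Lemma dual_normZ (k : K) f : dual_norm (k *: f) = `|k| * dual_norm f.
Proof.
apply/eqP; rewrite eq_le dual_normZ_le andTb.
have [->|k0] := eqVneq k 0.
  by rewrite normr0 mul0r ler0c opnorm_ge0//; exact: dualP.
have := dual_normZ_le k^-1 (k *: f); rewrite scalerA mulVf// scale1r normfV.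
by rewrite mulrC ler_pdivlMr ?normr_gt0// mulrC.
Qed.

Lemma dual_norm_eq0 f : dual_norm f = 0 -> f = 0.
Proof.
move=> f0; apply: dual_ext => x; apply/eqP; rewrite -normr_le0.
apply: le_trans (le_opnorm _ (dualP f)) _.
by rewrite -/(dual_norm f) f0 mul0r.
Qed.

HB.instance Definition _ := Lmodule_isNormed.Build K dual
  dual_normD dual_normZ dual_norm_eq0.

Lemma le_dual_norm (f : dual) x : `|f x| <= `|f| * `|x|.
Proof. exact: le_opnorm (dualP f). Qed.

Lemma dual_norm_le (f : dual) (M : R) : 0 <= M ->
  (forall x, `|f x| <= M%:C * `|x|) -> `|f| <= M%:C.
Proof. by move=> M0 fM; rewrite lecR; exact: opnorm_le. Qed.

End DualSpace.

(** * Completeness of the dual space *)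

Section Completeness.
Variable R : realType.
Local Notation K := (R[i]).
Local Open Scope complex_scope.

(** Positivity in the order of [R[i]] forces a zero imaginary part, so the complex tolerances of the
    definitions reduce to real ones. *)
Lemma pos_complexP (e : K) : 0 < e -> exists2 r : R, 0 < r & e = r%:C.
Proof.
move=> e0; have er := RRe_real (ger0_real (ltW e0)).
by exists (complex.Re e) => //; rewrite -ltcR er.
Qed.

Lemma real_cauchy_cvg (T : Type) (F : set_system T) (u : T -> R) :
  ProperFilter F ->
  (forall e : R, 0 < e -> exists2 A, F A & forall s t, A s -> A t -> `|u s - u t| < e) ->
  exists l, forall e : R, 0 < e -> F [set t | `|u t - l| < e].
Proof.
move=> FF Fc.
have : cvg (u @ F).
  apply: R_complete; apply: cauchy_exP => e e0.
  have [A FA Au] := Fc e e0; have [s As] := filter_ex FA.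
  exists (u s); apply: (@filterS _ F _ A _ _ FA) => t At.
  by rewrite /preimage /= -ball_normE /=; exact: Au.
move=> /cvg_ex[l /cvgrPdist_lt ul]; exists l => e e0.
by apply: filterS (ul e e0) => t; rewrite distrC.
Qed.

Lemma normc_ge_Im (z : K) : `|complex.Im z|%:C <= `|z|.
Proof.
have := normc_ge_Re (z * 'i); rewrite ReiNIm normrN normrM.
by rewrite [`|'i|]normc_def /= expr0n /= add0r expr1n sqrtr1 mulr1.
Qed.

Lemma normc_le_ReIm (z : K) : `|z| <= (`|complex.Re z| + `|complex.Im z|)%:C.
Proof.
rewrite normc_def lecR -[leRHS]ger0_norm ?addr_ge0// -sqrtr_sqr ler_wsqrtr//.
rewrite sqrrD !real_normK ?num_real// lerD2r lerDl mulrn_wge0//.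
Qed.

Lemma complex_cauchy_cvg (T : Type) (F : set_system T) (u : T -> K) :
  ProperFilter F ->
  (forall e : R, 0 < e ->
    exists2 A, F A & forall s t, A s -> A t -> `|u s - u t| < e%:C) ->
  exists l, forall e : R, 0 < e -> F [set t | `|u t - l| < e%:C].
Proof.
move=> FF Fc.
have [|a ua] := @real_cauchy_cvg _ F (fun t => complex.Re (u t)) FF.
  move=> e e0; have [A FA Au] := Fc e e0; exists A => // s t As At.
  rewrite -ltcR; apply: le_lt_trans (Au _ _ As At).
  by rewrite /= -raddfB; exact: normc_ge_Re.
have [|b ub] := @real_cauchy_cvg _ F (fun t => complex.Im (u t)) FF.
  move=> e e0; have [A FA Au] := Fc e e0; exists A => // s t As At.
  rewrite -ltcR; apply: le_lt_trans (Au _ _ As At).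
  by rewrite /= -raddfB; exact: normc_ge_Im.
exists (a +i* b) => e e0.
have e20 : 0 < e / 2 by rewrite divr_gt0.
apply: filterS2 (ua _ e20) (ub _ e20) => t /= ta tb.
apply: le_lt_trans (normc_le_ReIm _) _; rewrite ltcR.
by rewrite [ltRHS]splitr; apply: ltrD; move: ta tb; case: (u t).
Qed.

Lemma complex_le_eps (x y : K) : 0 <= x -> 0 <= y ->
  (forall e : R, 0 < e -> x <= y + e%:C) -> x <= y.
Proof.
move=> x0 y0; rewrite -(RRe_real (ger0_real x0)) -(RRe_real (ger0_real y0)).
move=> H; rewrite lecR; apply/ler_addgt0Pr => e e0.
by rewrite -lecR real_complexD H.
Qed.

Lemma complex_eps_eq0 (z c : K) : 0 <= c ->
  (forall e : R, 0 < e -> `|z| <= e%:C * c) -> z = 0.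
Proof.
move=> c0 H; apply/eqP; rewrite -normr_le0; apply: complex_le_eps => // e e0.
have c' := RRe_real (ger0_real c0).
have C0 : 0 <= complex.Re c by rewrite -lecR c'.
(* Dividing by [c + 1] instead of [c] covers the case [c = 0]. *)
rewrite add0r; apply: le_trans (H (e / (complex.Re c + 1)) _) _.
  by rewrite divr_gt0// ltr_wpDl.
rewrite -c' -real_complexM lecR mulrAC ler_pdivrMr ?ltr_wpDl//.
by rewrite ler_pM2l// lerDl.
Qed.

Variable X : normedModType K.

(** The limit [L] is built pointwise from the evaluations [f x]. The Cauchy estimate is uniform
    relative to [|x|], so it passes to [L]; this makes [L] linear and bounded, and turns pointwise
    convergence into norm convergence. *)
Lemma dual_complete (F : set_system (dual X)) :
  ProperFilter F -> cauchy F -> cvg F.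
Proof.
move=> FF /cauchyP Fex.
have Fc (e : R) : 0 < e -> exists2 A, F A &
    forall f g : dual X, A f -> A g -> forall x, `|f x - g x| <= e%:C * `|x|.
  move=> e0; have e20 : 0 < e / 2 by rewrite divr_gt0.
  have /Fex[h Fh] : 0 < (e / 2)%:C by rewrite ltcR.
  exists (ball h (e / 2)%:C) => // f g.
  rewrite -!ball_normE /= => hf hg x; rewrite -dualBE.
  apply: le_trans (le_dual_norm _ _) _; rewrite ler_wpM2r//.
  rewrite [e]splitr real_complexD ltW//.
  by apply: le_lt_trans (ler_distD h _ _) _; rewrite distrC ltrD.
have evc x : exists l : K, forall e : R, 0 < e -> F [set f | `|f x - l| < e%:C].
  apply: complex_cauchy_cvg => e e0.
  have x1 : 0 < complex.Re `|x| + 1.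
    by rewrite ltr_wpDl// -ler0c norm_Re.
  have /Fc[A FA Ae] : 0 < e / (complex.Re `|x| + 1) by rewrite divr_gt0.
  exists A => // f g Af Ag; apply: le_lt_trans (Ae _ _ Af Ag x) _.
  rewrite -norm_Re -real_complexM ltcR mulrAC ltr_pdivrMr// ltr_pM2l//.
  by rewrite ltrDl.
have [L LP] := choice evc.
have FL (e : R) : 0 < e -> exists2 A, F A &
    forall f : dual X, A f -> forall x, `|f x - L x| <= e%:C * `|x|.
  move=> e0; have [A FA Ae] := Fc e e0; exists A => // f Af x.
  apply: complex_le_eps => [//||d d0].
    by rewrite mulr_ge0// ler0c ltW.
  (* The intermediate [g] depends on [x] and [d], but the resulting bound on [f x - L x] does not
     depend on [g], and [d] is arbitrary. *)
  have [g [Ag gL]] := filter_ex (filterI FA (LP x d d0)).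
  by apply: le_trans (ler_distD (g x) _ _) _; rewrite lerD ?Ae// ltW.
have FL1 (e : R) : 0 < e -> exists f : dual X, forall x, `|f x - L x| <= e%:C * `|x|.
  by move=> /FL[A FA Ae]; have [f Af] := filter_ex FA; exists f; exact: Ae.
(* Each linearity defect of [L] is compared with the zero defect of a nearby [f], hence is smaller
   than every tolerance. *)
have dL : in_dual L.
  split=> [x y|]; last split=> [k x|].
  - apply/eqP; rewrite -subr_eq0; apply/eqP.
    apply: (@complex_eps_eq0 _ (`|x + y| + (`|x| + `|y|))); first by rewrite !addr_ge0.
    move=> e /FL1[f fL]; have [fD _] := dualP f.
    have -> : L (x + y) - (L x + L y) =
        (L (x + y) - f (x + y)) + ((f x - L x) + (f y - L y)) by rewrite fD; ring.
    rewrite !mulrDr; apply: le_trans (ler_normD _ _) _; apply: lerD.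
      by rewrite distrC.
    by apply: le_trans (ler_normD _ _) _; apply: lerD.
  - apply/eqP; rewrite -subr_eq0; apply/eqP.
    apply: (@complex_eps_eq0 _ (`|k *: x| + `|k| * `|x|)).
      by rewrite addr_ge0// mulr_ge0.
    move=> e /FL1[f fL]; have [_ [fZ _]] := dualP f.
    have -> : L (k *: x) - k * L x =
        (L (k *: x) - f (k *: x)) + k * (f x - L x) by rewrite fZ; ring.
    rewrite [leRHS]mulrDr; apply: le_trans (ler_normD _ _) _; apply: lerD.
      by rewrite distrC.
    by rewrite normrM mulrCA ler_wpM2l.
  - have [f fL] := FL1 1 ltr01; exists (`|f| + 1) => x.
    rewrite mulrDl -[L x](subrK (f x)) addrC; apply: le_trans (ler_normD _ _) _.
    by rewrite lerD ?le_dual_norm// distrC; exact: fL.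
apply/cvg_ex; exists (Dual (introT (dual_predP L) dL)).
apply/cvg_ballP => _ /pos_complexP[e e0 ->].
(* Half the tolerance, because [dual_norm_le] yields only a non-strict bound while balls are
   open. *)
have e20 : 0 < e / 2 by rewrite divr_gt0.
have [A FA AL] := FL _ e20; apply: filterS FA => f Af.
rewrite -ball_normE /=.
apply: (@le_lt_trans _ _ (e / 2)%:C); last first.
  by rewrite ltcR ltr_pdivrMr// ltr_pMr// ltr1n.
apply: dual_norm_le; first exact: ltW.
by move=> x; rewrite dualBE distrC; exact: AL.
Qed.

HB.instance Definition _ := Uniform_isComplete.Build (dual X) dual_complete.

End Completeness.

(** * Dual modules and approximate amenability *)

Lemma directed_finite_ub (I : Type) (le : I -> I -> Prop) (n : nat) (u : 'I_n -> I) :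
  directed le -> exists i, forall k, le (u k) i.
Proof.
move=> [[j0 _] [_ [le_tr le_ub]]]; elim: n u => [|n IHn] u.
  by exists j0 => -[].
have [i ui] := IHn (fun k => u (lift ord0 k)).
have [j [ij u0j]] := le_ub i (u ord0); exists j => k.
by case: (unliftP ord0 k) => [k'|] -> //; exact: le_tr (ui k') ij.
Qed.

Section DualModule.
Variable R : realType.
Local Notation K := (R[i]).
Local Open Scope complex_scope.

(** One form for left actions and flipped right actions, so that a single transpose construction
    handles all four actions of a module. *)
Definition bounded_action (A X : normedModType K) (op : A -> X -> X) : Prop :=
  bilinear_op op /\ exists M : K, forall a x, `|op a x| <= M * `|a| * `|x|.

Lemma bilinear_flip (A B X : normedModType K) (op : A -> B -> X) :
  bilinear_op op -> bilinear_op (fun b a => op a b).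
Proof. by move=> [? [? [? ?]]]. Qed.

Lemma bounded_action_flip (A X : normedModType K) (op : X -> A -> X) :
  bilinear_op op -> (exists M : K, forall x a, `|op x a| <= M * `|x| * `|a|) ->
  bounded_action (fun a x => op x a).
Proof.
move=> bop [M opM]; split; first exact: bilinear_flip.
by exists M => a x; rewrite mulrAC.
Qed.

Section Transpose.
Variable X : normedModType K.

(* [mk_dual g] is [0] when [g] is not a bounded functional. *)
Definition mk_dual (g : X -> K) : dual X := insubd 0 (g : X -> K^o).

Lemma mk_dualE (g : X -> K) x : in_dual g -> mk_dual g x = g x.
Proof.
by move=> dg; have := insubdK 0 (introT (dual_predP (g : X -> K^o)) dg) => /= ->.
Qed.

Definition transpose (A : normedModType K) (op : A -> X -> X) (a : A)
  (f : dual X) : dual X := mk_dual (fun x => f (op a x)).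

Variables (A : normedModType K) (op : A -> X -> X).
Hypothesis bop : bounded_action op.

Lemma transposeE a f x : transpose op a f x = f (op a x).
Proof.
apply: mk_dualE; case: bop => [[_ [opD [_ opZ]]] [M opM]].
case: (dualP f) => fD [fZ _]; split; first by move=> y z; rewrite opD fD.
split; first by move=> k y; rewrite opZ fZ.
exists (`|f| * (M * `|a|)) => y; apply: le_trans (le_dual_norm _ _) _.
by rewrite -mulrA ler_wpM2l.
Qed.

Lemma bounded_action_transpose : bounded_action (transpose op).
Proof.
split.
  case: bop => [[opD [_ [opZ _]]] _]; split.
    by move=> a b f; apply: dual_ext => x; rewrite dualDE !transposeE opD (dualP f).1.
  split; first by move=> a f g; apply: dual_ext => x; rewrite dualDE !transposeE.
  split.
    by move=> k a f; apply: dual_ext => x; rewrite dualZE !transposeE opZ (dualP f).2.1.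
  by move=> k a f; apply: dual_ext => x; rewrite dualZE !transposeE.
case: bop => _ [M opM]; exists `|M| => a f.
(* The constant is put in the form of a real number, as [dual_norm_le] requires. *)
have -> : `|M| * `|a| * `|f| =
    (complex.Re `|M| * complex.Re `|a| * complex.Re `|f|)%:C.
  by rewrite !real_complexM !norm_Re RRe_real ?normr_real.
apply: dual_norm_le.
  by rewrite -ler0c !real_complexM !norm_Re RRe_real ?normr_real// !mulr_ge0.
move=> x; rewrite transposeE !real_complexM !norm_Re RRe_real ?normr_real//.
apply: le_trans (le_dual_norm _ _) _.
rewrite [_ * `|f|]mulrC -[leRHS]mulrA ler_wpM2l// -mulrA.
by apply: ler_normM; rewrite ?mulr_ge0// mulrA.
Qed.

End Transpose.

Section DualBimodule.
Variables (C Cm : normedModType K) (mulC : C -> C -> C) (mulCm : Cm -> Cm -> Cm)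
  (lC : Cm -> C -> C) (rC : C -> Cm -> C).
Variables (X : normedModType K) (lX : C -> X -> X) (rX : X -> C -> X)
  (laX : Cm -> X -> X) (raX : X -> Cm -> X).

(** Dualising swaps sides: [(c.f)(x) = f(x.c)] transposes the right action, and [(f.c)(x) = f(c.x)]
    transposes the left one. *)
Definition dual_lact (A : normedModType K) (op : X -> A -> X) : A -> dual X -> dual X :=
  transpose (fun a x => op x a).

Definition dual_ract (A : normedModType K) (op : A -> X -> X) : dual X -> A -> dual X :=
  fun f a => transpose op a f.

Lemma banach_module_actions :
  banach_module mulC mulCm lC rC lX rX laX raX ->
  [/\ bounded_action lX, bounded_action (fun c x => rX x c),
      bounded_action laX & bounded_action (fun a x => raX x a)].
Proof.
move=> [bl [br [Ml [Mr [_ [_ [_ [bla [bra [Mla [Mra _]]]]]]]]]]].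
by split=> //; exact: bounded_action_flip.
Qed.

(** The axioms are closed under swapping sides. Evaluated at [x], associativity on one side becomes
    associativity on the other, and the mixed identities pair up as [e7] with [e11], [e8] with
    [e10], [e9] with [e12]; [e3] and [e6] are self-dual. *)
Lemma dual_banach_module :
  banach_module mulC mulCm lC rC lX rX laX raX ->
  banach_module mulC mulCm lC rC (dual_lact rX) (dual_ract lX)
    (dual_lact raX) (dual_ract laX).
Proof.
move=> mX; have [al ar ala ara] := banach_module_actions mX.
have ract_bounded (B : normedModType K) (op : B -> X -> X) : bounded_action op ->
    bilinear_op (dual_ract op) /\
    exists M : K, forall f b, `|dual_ract op f b| <= M * `|f| * `|b|.
  move=> /bounded_action_transpose[bt [M tM]]; split; first exact: bilinear_flip.
  by exists M => f b; rewrite mulrAC; exact: tM.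
case: mX => [_ [_ [_ [_ [e1 [e2 [e3 [_ [_ [_ [_ [e4 [e5 [e6 [e7 [e8 [e9 [e10
  [e11 e12]]]]]]]]]]]]]]]]]]].
split; first by case: (bounded_action_transpose ar).
split; first by case: (ract_bounded _ _ al).
split; first by case: (bounded_action_transpose ar).
split; first by case: (ract_bounded _ _ al).
split; first by move=> c d f; apply: dual_ext => x; rewrite !transposeE// e2.
split; first by move=> f c d; apply: dual_ext => x; rewrite !transposeE// e1.
split; first by move=> c f d; apply: dual_ext => x; rewrite !transposeE// e3.
split; first by case: (bounded_action_transpose ara).
split; first by case: (ract_bounded _ _ ala).
split; first by case: (bounded_action_transpose ara).
split; first by case: (ract_bounded _ _ ala).
split; first by move=> a b f; apply: dual_ext => x; rewrite !transposeE// e5.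
split; first by move=> f a b; apply: dual_ext => x; rewrite !transposeE// e4.
split; first by move=> a f b; apply: dual_ext => x; rewrite !transposeE// e6.
split; first by move=> a c f; apply: dual_ext => x; rewrite !transposeE// e11.
split; first by move=> c a f; apply: dual_ext => x; rewrite !transposeE// e10.
split; first by move=> c f a; apply: dual_ext => x; rewrite !transposeE// e12.
split; first by move=> f c a; apply: dual_ext => x; rewrite !transposeE// e8.
split; first by move=> f a c; apply: dual_ext => x; rewrite !transposeE// e7.
by move=> a f c; apply: dual_ext => x; rewrite !transposeE// e9.
Qed.

Lemma dual_commutative_module :
  commutative_module laX raX ->
  commutative_module (dual_lact raX) (dual_ract laX).
Proof.
move=> cX a f; rewrite /dual_lact /dual_ract /transpose; congr mk_dual.
by apply/funext => x; rewrite cX.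
Qed.

End DualBimodule.

(** * The cycle of implications between the three approximate properties *)

Section Amenability.
Variables (C Cm : normedModType K) (mulC : C -> C -> C) (mulCm : Cm -> Cm -> Cm)
  (lC : Cm -> C -> C) (rC : C -> Cm -> C).

Lemma contractible_amenable :
  module_approx_contractible mulC mulCm lC rC ->
  module_approx_amenable mulC mulCm lC rC.
Proof.
move=> hC X lX rX laX raX D mX cX [Dd [DD [[M DM] [DC [Dl Dr]]]]].
have [al ar ala ara] := banach_module_actions mX.
pose D' c := mk_dual (D c).
have D'E c x : D' c x = D c x by rewrite /D' mk_dualE.
have [|I [le [f [dirI fD]]]] := hC (dual X) _ _ _ _ D' (dual_banach_module mX)
    (dual_commutative_module cX).
  split; first by move=> c d; apply: dual_ext => x; rewrite dualDE !D'E DD.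
  split.
    exists `|M| => c.
    have -> : `|M| * `|c| = (complex.Re `|M| * complex.Re `|c|)%:C.
      by rewrite real_complexM !norm_Re RRe_real ?normr_real.
    apply: dual_norm_le => [|x].
      by rewrite -ler0c real_complexM norm_Re RRe_real ?normr_real// mulr_ge0.
    rewrite real_complexM norm_Re RRe_real ?normr_real// D'E -mulrA.
    by apply: ler_normM; rewrite ?mulr_ge0// mulrA.
  split.
    by move=> c d; apply: dual_ext => x; rewrite dualDE !transposeE// !D'E DC.
  split; first by move=> a c; apply: dual_ext => x; rewrite transposeE// !D'E Dl.
  by move=> c a; apply: dual_ext => x; rewrite transposeE// !D'E Dr.
exists I, le, (fun i => f i : X -> K); split=> //; split; first by move=> i; exact: dualP.
move=> c e e0; have [i0 fi0] := fD c e e0; exists i0 => i /fi0 H x.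
(* The error at [x] is the value of one element of the dual, so its norm bounds the error uniformly
   in [x]. *)
have -> : f i (rX x c) - f i (lX c x) - D c x =
    (dual_lact rX c (f i) - dual_ract lX (f i) c - D' c) x.
  by rewrite !dualBE !transposeE// D'E.
by apply: le_trans (le_dual_norm _ _) _; rewrite ler_wpM2r// ltW.
Qed.

Lemma amenable_wstar :
  module_approx_amenable mulC mulCm lC rC ->
  module_wstar_approx_amenable mulC mulCm lC rC.
Proof.
move=> hA X lX rX laX raX D mX cX dD.
have [I [le [f [dirI [fd fD]]]]] := hA X _ _ _ _ D mX cX dD.
exists I, le, f; split=> //; split=> // c x e e0.
have x1 : 0 < `|x| + 1 by rewrite ltr_wpDl.
have [i0 fi0] := fD c (e / (`|x| + 1)) (divr_gt0 e0 x1).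
exists i0 => i /fi0 /(_ x) H; apply: le_lt_trans H _.
by rewrite mulrAC ltr_pdivrMr// ltr_pM2l// ltrDl.
Qed.

Lemma wstar_finite_approx (X : completeNormedModType K) (lX : C -> X -> X)
    (rX : X -> C -> X) (laX : Cm -> X -> X) (raX : X -> Cm -> X) (D : C -> X) :
  module_wstar_approx_amenable mulC mulCm lC rC ->
  banach_module mulC mulCm lC rC lX rX laX raX ->
  commutative_module laX raX ->
  module_derivation mulC lC rC lX rX laX raX D ->
  forall (s : seq C) (e : R), 0 < e ->
    exists x, forall c, c \in s -> `|lX c x - rX x c - D c| < e%:C.
Proof.
move=> hW mX cX [DD [[M DM] [DC [Dl Dr]]]] s e e0.
have [al ar ala ara] := banach_module_actions mX.
(* [D] followed by the canonical map into the bidual, viewed as a derivation into the dual of the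
   module [dual X]. *)
pose D' c (f : dual X) : K := f (D c).
have [|I [le [f [dirI [fd fD]]]]] := hW (dual X) _ _ _ _ D' (dual_banach_module mX)
    (dual_commutative_module cX).
  split.
    move=> c; split=> //; split=> //; exists `|D c| => g.
    by rewrite mulrC le_dual_norm.
  split; first by move=> c d g; rewrite /D' DD (dualP g).1.
  split.
    exists M => c g; apply: le_trans (le_dual_norm _ _) _.
    by rewrite mulrC ler_wpM2r.
  split; first by move=> c d g; rewrite /D' DC (dualP g).1 !transposeE.
  split; first by move=> a c g; rewrite /D' Dl transposeE.
  by move=> c a g; rewrite /D' Dr transposeE.
pose n := size s; pose V := {ffun 'I_n -> X}.
(* The sum norm on [X^n] dominates every coordinate and gives each coordinate embedding [delta k]
   norm at most [1]. *)
pose N (y : V) : R := \sum_k complex.Re `|y k|.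
pose T (x : X) : V := [ffun k : 'I_n => lX s`_k x - rX x s`_k].
pose d : V := [ffun k : 'I_n => D s`_k].
have sN : seminorm N.
  split=> [y z|k y].
    rewrite -big_split; apply: ler_sum => k _; rewrite ffunE.
    by rewrite -lecR real_complexD !norm_Re ler_normD.
  rewrite /N mulr_sumr; apply: eq_bigr => i _; rewrite ffunE.
  apply: complexI; rewrite real_complexM !norm_Re RRe_real ?normr_real//.
  exact: normrZ.
have TD x y : T (x + y) = T x + T y.
  case: al ar => [[_ [lD _]] _] [[_ [rD _]] _].
  by apply/ffunP => k; rewrite !ffunE lD rD opprD addrACA.
have TZ (k : K) x : T (k *: x) = k *: T x.
  case: al ar => [[_ [_ [_ lZ]]] _] [[_ [_ [_ rZ]]] _].
  by apply/ffunP => i; rewrite !ffunE lZ rZ scalerBr.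
have [||||H] := @subspace_separation R V N (range T) d sN.
- by exists 0 => //; rewrite -[0 in LHS](scale0r 0) TZ scale0r.
- by move=> _ _ [x _ <-] [y _ <-]; exists (x + y).
- by move=> k _ [x _ <-]; exists (k *: x).
- move=> /(_ e e0)[_ [x _ <-] Nx]; exists x => c cs.
  have ci : (index c s < n)%N by rewrite index_mem.
  pose k := Ordinal ci.
  have sk : s`_k = c by rewrite /= nth_index.
  apply: le_lt_trans (_ : (N (d - T x))%:C < _); last by rewrite ltcR.
  rewrite distrC -norm_Re lecR /N (bigD1 k)//= !ffunE sk -[leLHS]addr0 lerD//.
  by apply: sumr_ge0 => i _; rewrite -ler0c norm_Re.
(* It remains to refute the separating [F], by proving [F d = 0]. *)
case: H => F [FD FZ FN FT /negP[]]; apply/eqP.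
pose delta (k : 'I_n) (z : X) : V := [ffun j => if j == k then z else 0].
pose phi k : dual X := mk_dual (fun z => F (delta k z)).
have phiE k z : phi k z = F (delta k z).
  apply: mk_dualE; split.
    move=> x y; rewrite -FD; congr F; apply/ffunP => j; rewrite !ffunE.
    by case: ifP => // _; rewrite addr0.
  split.
    move=> a x; rewrite -FZ; congr F; apply/ffunP => j; rewrite !ffunE.
    by case: ifP => // _; rewrite scaler0.
  exists 1 => x; rewrite mul1r; apply: le_trans (FN _) _.
  rewrite -norm_Re lecR /N (bigD1 k)//= ffunE eqxx big1 ?addr0//.
  by move=> j jk; rewrite ffunE (negbTE jk) normr0.
have F0 : F 0 = 0 by rewrite -(scale0r 0) FZ mul0r.
have Fsum (y : V) : F y = \sum_k phi k (y k).
  have -> : y = \sum_k delta k (y k).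
    apply/ffunP => j; rewrite sum_ffunE (bigD1 j)//= ffunE eqxx big1 ?addr0//.
    by move=> k kj; rewrite ffunE eq_sym (negbTE kj).
  rewrite (big_morph F FD F0); apply: eq_bigr => k _.
  rewrite phiE; congr (F (delta _ _)).
  rewrite sum_ffunE (bigD1 k)//= ffunE eqxx big1 ?addr0//.
  by move=> j jk; rewrite ffunE eq_sym (negbTE jk).
(* That [F] vanishes on every [T x] says exactly that the commutators of the components [phi k] sum
   to zero in the dual. *)
have comm0 : \sum_k (dual_ract lX (phi k) s`_k - dual_lact rX s`_k (phi k)) = 0.
  apply: dual_ext => x.
  rewrite (big_morph (fun g : dual X => g x) (fun g h => dualDE g h x) erefl).
  transitivity (F (T x)); last by rewrite FT//; exists x.
  rewrite Fsum; apply: eq_bigr => k _.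
  rewrite dualBE !transposeE// ffunE.
  by rewrite (in_dualB _ _ (dualP (phi k))).
rewrite Fsum; apply: (@complex_eps_eq0 _ _ n%:R); first exact: ler0n.
move=> r r0; have rC0 : 0 < r%:C by rewrite ltcR.
have /choice[i0 i0P] (k : 'I_n) := fD s`_k (phi k) r%:C rC0.
(* One index of the net works for all [n] pairs of [s_k] and [phi k], since only finitely many weak*
   conditions are imposed. *)
have [i ile] := directed_finite_ub i0 dirI.
have fi0 : f i 0 = 0 by rewrite -(scale0r 0) (fd i).2.1 mul0r.
have fi_comm : \sum_k (f i (dual_ract lX (phi k) s`_k)
                       - f i (dual_lact rX s`_k (phi k))) = 0.
  rewrite -[RHS]fi0 -[X in f i X]comm0 (big_morph (f i) (fd i).1 fi0).
  apply: eq_bigr => k _.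
  by rewrite (in_dualB _ _ (fd i)).
(* Subtracting the zero sum [fi_comm] compares [F d] with the net term by term: [n] errors, each
   below [r]. *)
rewrite -[X in `|X|]subr0 -[X in _ - X]fi_comm -sumrB.
apply: le_trans (ler_norm_sum _ _ _) _.
rewrite mulr_natr -[n in leRHS]card_ord -sumr_const; apply: ler_sum => k _.
by rewrite ffunE distrC ltW//; exact: i0P.
Qed.

Lemma wstar_contractible :
  module_wstar_approx_amenable mulC mulCm lC rC ->
  module_approx_contractible mulC mulCm lC rC.
Proof.
move=> hW X lX rX laX raX D mX cX dD.
have approx := wstar_finite_approx hW mX cX dD.
pose I := (seq C * {posnum R})%type.
have /choice[x xP] (i : I) : exists x, forall c, c \in i.1 ->
    `|lX c x - rX x c - D c| < (i.2%:num)%:C by exact: approx.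
exists I, (fun i j => {subset i.1 <= j.1} /\ j.2%:num <= i.2%:num), x.
split.
  split; first by exists ([::], 1%:pos).
  split; first by move=> i; split.
  split.
    move=> i j k [ij ji] [jk kj]; split; first by move=> c /ij /jk.
    exact: le_trans kj ji.
  (* Concatenating the lists and taking the smaller tolerance refines both indices. *)
  move=> i j; exists (i.1 ++ j.1, (Num.min i.2%:num j.2%:num)%:pos).
  split; split=> /=; rewrite ?ge_min ?lexx ?orbT//.
    by move=> c ci; rewrite mem_cat ci.
  by move=> c cj; rewrite mem_cat cj orbT.
move=> c _ /pos_complexP[e e0 ->].
exists ([:: c], PosNum e0) => i [ci ie]; apply: lt_le_trans (xP i c _) _.
  by apply: ci; rewrite mem_head.
by rewrite lecR.
Qed.

End Amenability.
End DualModule.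

Theorem theorem3p5 (R : realType) (U A : completeNormedModType R[i])
  (mulU : U -> U -> U) (mulA : A -> A -> A)
  (l : U -> A -> A) (r : A -> U -> A) :
  banach_algebra mulU -> banach_algebra mulA ->
  banach_bimodule_compat mulU mulA l r ->
  (module_approx_contractible (B_mul mulU mulA l r) (unitz_mul mulU)
     (B_lact mulU l) (B_ract mulU r) <->
   module_approx_amenable (B_mul mulU mulA l r) (unitz_mul mulU)
     (B_lact mulU l) (B_ract mulU r)) /\
  (module_approx_amenable (B_mul mulU mulA l r) (unitz_mul mulU)
     (B_lact mulU l) (B_ract mulU r) <->
   module_wstar_approx_amenable (B_mul mulU mulA l r) (unitz_mul mulU)
     (B_lact mulU l) (B_ract mulU r)).
Proof.
move=> _ _ _; split; split.
(* Each converse goes the rest of the way round the cycle: amenable to contractible through the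
   weak* property, and weak* to amenable through contractibility. *)
- exact: contractible_amenable.
- by move=> /amenable_wstar/wstar_contractible.
- exact: amenable_wstar.
- by move=> /wstar_contractible/contractible_amenable.
Qed.
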